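(* Let $G=(V,E)$ be a $(D,2)$-Bonnet-Myers sharp graph. Then $G$ is isomorphic to a cocktail party graph $CP(n)$ for some $n\ge2$.
   Context: All graphs are finite, simple, undirected, unweighted, connected, and have at least one edge. $d$ denotes the combinatorial distance and $\mathrm{diam}(G)=\max_{x,y}d(x,y)$; $x\sim y$ means that $x,y$ are adjacent. For a $D$-regular graph $G=(V,E)$ and $x\in V$, let $\mu_x$ be the probability measure on $V$ giving mass $\frac1{D+1}$ to $x$ and to each of its $D$ neighbours. The Wasserstein distance of probability measures $\mu,\nu$ on $V$ is $W_1(\mu,\nu)=\inf_\pi\sum_{u,v\in V}d(u,v)\pi(u,v)$, where $\pi:V\times V\to[0,1]$ runs over all couplings with marginals $\mu$ and $\nu$. The (modified) Ollivier Ricci curvature of two different vertices $x,y$ is $$\kappa(x,y)=\frac{D+1}{D}\left(1-\frac{W_1(\mu_x,\mu_y)}{d(x,y)}\right).$$ A $D$-regular graph $G$ of diameter $L$ is called $(D,L)$-Bonnet-Myers sharp if $\inf_{x\sim y}\kappa(x,y)=\frac2L$. The cocktail party graph $CP(n)$ has vertices $u_1,\dots,u_n,v_1,\dots,v_n$, any two distinct vertices being adjacent unless they share the same subscript. *)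

(* Defs.v *)
From mathcomp Require Import all_boot all_order all_algebra.
From mathcomp Require Import all_classical all_reals.

Set Implicit Arguments.
Unset Strict Implicit.
Unset Printing Implicit Defensive.

Import Order.TTheory GRing.Theory Num.Theory.
Local Open Scope classical_set_scope.
Local Open Scope ring_scope.

Definition is_graph (V : finType) (e : rel V) : Prop :=
  [/\ symmetric e, irreflexive e,
      (forall x y, connect e x y) & (exists x y, e x y)].

Definition regular_graph (V : finType) (e : rel V) (D : nat) : Prop :=
  forall x, #|[pred y | e x y]| = D.

(* Least length of a walk from x to y. Lengths below #|V| suffice in a
   connected graph; the value is #|V| if there is no walk. *)
Definition gdist (V : finType) (e : rel V) (x y : V) : nat :=
  find (fun n => [exists p : n.-tuple V, path e x p && (last x p == y)])
       (iota 0 #|V|).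

Definition gdiam (V : finType) (e : rel V) : nat :=
  (\max_(x : V) \max_(y : V) gdist e x y)%N.

Definition ball_measure (R : realType) (V : finType) (e : rel V) (D : nat)
    (x : V) : V -> R :=
  fun z => if (z == x) || e x z then (D.+1%:R)^-1 else 0.

Definition coupling (R : realType) (V : finType) (mu nu : V -> R)
    (pi : V -> V -> R) : Prop :=
  [/\ forall u v, 0 <= pi u v <= 1,
      forall u, \sum_(v : V) pi u v = mu u
    & forall v, \sum_(u : V) pi u v = nu v].

Definition W1 (R : realType) (V : finType) (e : rel V) (mu nu : V -> R) : R :=
  inf [set c : R | exists2 pi : V -> V -> R, coupling mu nu pi
         & c = \sum_(u : V) \sum_(v : V) (gdist e u v)%:R * pi u v].

Definition kappa (R : realType) (V : finType) (e : rel V) (D : nat)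
    (x y : V) : R :=
  D.+1%:R / D%:R *
  (1 - W1 e (ball_measure R e D x) (ball_measure R e D y) / (gdist e x y)%:R).

Definition bonnet_myers_sharp (R : realType) (V : finType) (e : rel V)
    (D L : nat) : Prop :=
  [/\ regular_graph e D, gdiam e = L
    & inf [set k : R | exists x y, e x y /\ k = kappa R e D x y] = 2%:R / L%:R].

(* The vertices u_i and v_i are encoded as (i, true) and (i, false). *)
Definition cocktail_party (n : nat) : rel ('I_n * bool) :=
  fun p q => (p != q) && (p.1 != q.1).

Definition graph_iso (V W : finType) (e : rel V) (f : rel W) : Prop :=
  exists2 phi : V -> W, bijective phi & forall x y, f (phi x) (phi y) = e x y.

(* Main.v *)
Require Import Defs.
From mathcomp Require Import all_boot all_order all_algebra.
From mathcomp Require Import all_classical all_reals.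

(** For diameter 2 sharpness says that every edge has curvature at least 1,
    that is [W1 mu_x mu_y <= 1 / (D + 1)]: at most one unit of mass, in units
    of [1 / (D + 1)], has to move one step.  Only the easy half of Kantorovich
    duality ([lipschitz_le_W1]) is needed to exploit this: every 1-Lipschitz
    [f : V -> nat] has a sum over the ball around [x] that exceeds its sum over
    the ball around [y] by at most 1 ([sharp_ball_sum]).

    Two test functions carry the proof.  The indicator of
    [ball x :\: ball y] shows that this set has at most one element
    ([ball_diff_unique]).  The distance to a vertex [z] of [ball y :\: ball x],
    truncated at 2, shows that the vertex of [ball x :\: ball y], if any, is
    adjacent to [z] ([ball_diff_adjacent]).  Since the diameter is 2,
    non-adjacent distinct [x] and [z] have a common neighbour [y], and the two
    facts, applied to the edges at [y], place every neighbour of [x] among those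
    of [z] ([nonadjacent_twins]).  Consequently three pairwise distinct vertices
    [x], [z], [z'] with [z] and [z'] not adjacent to [x] would have a common
    neighbour [y], and [ball y :\: ball x] would contain both [z] and [z'];
    so a vertex has at most one non-neighbour.  By regularity all vertices have
    equally many, and the diameter is not 1, so each has exactly one.
    Non-adjacency is thus a fixed-point free involution, which is the
    description of a cocktail party graph. *)

Set Implicit Arguments.
Unset Strict Implicit.
Unset Printing Implicit Defensive.

Import Order.TTheory GRing.Theory Num.Theory.
Local Open Scope ring_scope.

(** * The combinatorial distance *)

Section Distance.
Variables (V : finType) (e : rel V).
Implicit Types (x y u v : V) (p : seq V).

Lemma gdist_le_size x y p : path e x p -> last x p = y ->
  (gdist e x y <= size p)%N.
Proof.
move=> pth lst; rewrite leqNgt; apply/negP => lt.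
have ltV : (size p < #|V|)%N.
  by apply: leq_trans lt _; rewrite -[leqRHS](size_iota 0); apply: find_size.
move: (before_find 0%N lt); rewrite nth_iota // add0n => /existsP; apply.
by exists (in_tuple p); rewrite /= pth lst eqxx.
Qed.

(** The bound is needed because [#|V|] is the value taken when there is no
    walk. *)
Lemma gdist_walk x y : (gdist e x y < #|V|)%N ->
  exists p, [/\ size p = gdist e x y, path e x p & last x p = y].
Proof.
move=> lt; have := lt; rewrite -[ltnRHS](size_iota 0) -has_find.
move=> /(nth_find 0%N); rewrite -/(gdist e x y) nth_iota // add0n.
by case/existsP=> p /andP[pth /eqP lst]; exists p; rewrite size_tuple.
Qed.

Lemma gdist_gt0 u v : u != v -> (0 < gdist e u v)%N.
Proof.
move=> uv; rewrite lt0n; apply/eqP => d0.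
have [|p []] := @gdist_walk u v.
  by rewrite d0; apply/card_gt0P; exists u.
by rewrite d0 => /size0nil -> _ /= /eqP; rewrite (negPf uv).
Qed.

Lemma card_gt1_neq u v : u != v -> (1 < #|V|)%N.
Proof. by move=> uv; apply/card_gt1P; exists u, v. Qed.

Lemma gdist_gt1 u v : u != v -> ~~ e u v -> (1 < gdist e u v)%N.
Proof.
move=> uv nuv; rewrite ltnNge; apply/negP => d1.
have d_eq : gdist e u v = 1%N by apply/eqP; rewrite eqn_leq d1 gdist_gt0.
have [|p []] := @gdist_walk u v; first by rewrite d_eq (card_gt1_neq uv).
rewrite d_eq; case: p => [|a [|b p]] //= _; rewrite andbT => eua av.
by move: nuv; rewrite -av eua.
Qed.

Lemma gdist_le_diam u v : (gdist e u v <= gdiam e)%N.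
Proof.
apply: leq_trans (leq_bigmax (F := fun x => \max_y gdist e x y)%N u).
exact: (leq_bigmax (F := fun y => gdist e u y)).
Qed.

Lemma gdist_edge x y : irreflexive e -> e x y -> gdist e x y = 1%N.
Proof.
move=> irr exy; apply/eqP; rewrite eqn_leq gdist_gt0 ?andbT.
  by apply: (@gdist_le_size x y [:: y]); rewrite //= exy.
by apply: contraTneq exy => ->; rewrite irr.
Qed.

End Distance.

(** * Lipschitz functions bound the Wasserstein distance from below *)

Section Transport.
Variables (R : realType) (V : finType) (e : rel V).

Lemma coupling_product (mu nu : V -> R) :
    (forall u, 0 <= mu u) -> (forall v, 0 <= nu v) ->
    \sum_u mu u = 1 -> \sum_v nu v = 1 ->
  coupling mu nu (fun u v => mu u * nu v).
Proof.
have le1 (rho : V -> R) a : (forall u, 0 <= rho u) -> \sum_u rho u = 1 ->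
    rho a <= 1.
  by move=> rho0 <-; rewrite (bigD1 a) //= lerDl sumr_ge0.
move=> mu0 nu0 mu1 nu1; split=> [u v|u|v].
- by rewrite mulr_ge0 // mulr_ile1 // le1.
- by rewrite -mulr_sumr nu1 mulr1.
- by rewrite -mulr_suml mu1 mul1r.
Qed.

(** Integrating [f u - f v <= d u v] against a coupling bounds its cost; the
    product coupling rules out an infimum over the empty set. *)
Lemma lipschitz_le_W1 (mu nu f : V -> R) :
    (forall u, 0 <= mu u) -> (forall v, 0 <= nu v) ->
    \sum_u mu u = 1 -> \sum_v nu v = 1 ->
    (forall u v, f u - f v <= (gdist e u v)%:R) ->
  \sum_u f u * mu u - \sum_v f v * nu v <= W1 e mu nu.
Proof.
move=> mu0 nu0 mu1 nu1 lip; apply: lb_le_inf.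
  by eexists; exists (fun u v => mu u * nu v) => //; apply: coupling_product.
move=> _ [pi [pi01 pil pir] ->].
under eq_bigr do rewrite -pil mulr_sumr.
under [X in _ - X]eq_bigr do rewrite -pir mulr_sumr.
rewrite [X in _ - X]exchange_big /= -sumrB; apply: ler_sum => u _.
rewrite -sumrB; apply: ler_sum => v _; rewrite -mulrBl ler_wpM2r //.
by case/andP: (pi01 u v).
Qed.

End Transport.

(** * Balls and the curvature condition on an edge *)

Definition ball (V : finType) (e : rel V) (x : V) : {set V} :=
  [set z | (z == x) || e x z].

Section SharpEdges.
Variables (R : realType) (V : finType) (e : rel V) (D : nat).
Hypotheses (irr : irreflexive e) (reg : regular_graph e D).

Lemma card_ball x : #|ball e x| = D.+1.
Proof.
have -> : ball e x = x |: [set z | e x z] by apply/setP => z; rewrite !inE.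
by rewrite cardsU1 inE irr add1n cardsE reg.
Qed.

Lemma sum_ball_measure (f : V -> R) x :
  \sum_z f z * ball_measure R e D x z = (\sum_(z in ball e x) f z) / D.+1%:R.
Proof.
rewrite mulr_suml [RHS]big_mkcond /=; apply: eq_bigr => z _.
by rewrite /ball_measure inE; case: ifP => _; rewrite ?mulr0.
Qed.

Lemma ball_measure_ge0 x z : 0 <= ball_measure R e D x z.
Proof. by rewrite /ball_measure; case: ifP => _; rewrite ?invr_ge0. Qed.

Lemma ball_measure_sum1 x : \sum_z ball_measure R e D x z = 1.
Proof.
under eq_bigr do rewrite -[ball_measure _ _ _ _ _]mul1r.
by rewrite (sum_ball_measure (fun=> 1)) sumr_const card_ball divff ?pnatr_eq0.
Qed.

(** The infimum of a set that is empty or unbounded below is 0 by convention,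
    so the value 1 forces the infimum to be a genuine lower bound. *)
Lemma sharp_kappa_ge1 x y : bonnet_myers_sharp R e D 2 -> e x y ->
  1 <= kappa R e D x y.
Proof.
case=> _ _; rewrite divff ?pnatr_eq0 // => inf1 exy; rewrite -inf1.
apply: ge_inf; last by exists x, y.
case: (boolp.EM (has_inf
    [set k : R | exists x0 y0, e x0 y0 /\ k = kappa R e D x0 y0]%classic)).
  by case.
move=> /inf_out inf0; move: inf1; rewrite inf0 => /esym/eqP.
by rewrite oner_eq0.
Qed.

(** [kappa x y >= 1] unfolds to [W1 <= 1 - D / (D + 1) = 1 / (D + 1)], and
    the factor [1 / (D + 1)] of the ball measures cancels. *)
Lemma sharp_ball_sum (f : V -> nat) x y :
    bonnet_myers_sharp R e D 2 -> e x y ->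
    (forall u v, f u <= f v + gdist e u v)%N ->
  (\sum_(z in ball e x) f z <= (\sum_(z in ball e y) f z).+1)%N.
Proof.
move=> sharp exy lip.
have D_gt0 : (0 < D)%N by rewrite -(reg x); apply/card_gt0P; exists y.
have := sharp_kappa_ge1 sharp exy.
rewrite /kappa (gdist_edge irr exy) divr1 mulrAC ler_pdivlMr ?ltr0n //.
rewrite mul1r mulrBr mulr1 lerBrDr -lerBrDl -natrB // subSnn => W1_le.
have := @lipschitz_le_W1 R V e (ball_measure R e D x) (ball_measure R e D y)
  (fun z => (f z)%:R) (ball_measure_ge0 x) (ball_measure_ge0 y)
  (ball_measure_sum1 x) (ball_measure_sum1 y).
rewrite !sum_ball_measure -mulrBl ler_pdivrMr ?ltr0n // mulrC => le_W1.
rewrite -(ler_nat R) -addn1 natrD !natr_sum addrC -lerBlDr.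
apply: le_trans W1_le; rewrite mulrC in le_W1; rewrite mulrC; apply: le_W1.
by move=> u v; rewrite lerBlDl -natrD ler_nat.
Qed.

End SharpEdges.

(** * Non-adjacency in a sharp graph of diameter 2 *)

Section SharpGraph.
Variables (V : finType) (e : rel V).
Hypotheses (sym : symmetric e) (irr : irreflexive e).
Hypothesis ball_sum : forall (f : V -> nat) x y, e x y ->
  (forall u v, f u <= f v + gdist e u v)%N ->
  (\sum_(z in ball e x) f z <= (\sum_(z in ball e y) f z).+1)%N.

(** The indicator of [ball e x :\: ball e y] is 1-Lipschitz, as distinct vertices
    are at distance at least 1, and it vanishes on [ball e y]. *)
Lemma ball_diff_unique x y a b : e x y ->
  a \in ball e x :\: ball e y -> b \in ball e x :\: ball e y -> a = b.
Proof.
move=> exy; set A := ball e x :\: ball e y => aA bA.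
suff /card_le1_eqP/(_ b a bA aA) : (#|A| <= 1)%N by [].
have := @ball_sum (fun z => (z \in A) : nat) x y exy.
rewrite [X in (_ <= X.+1)%N]big1; last first.
  by move=> z zy; rewrite inE zy.
have -> : (\sum_(z in ball e x) (z \in A) = #|A|)%N.
  rewrite -sum1_card big_mkcond [RHS]big_mkcond; apply: eq_bigr => z _.
  by rewrite /A finset.in_setD; case: (z \in ball e x); case: (z \in ball e y).
apply=> u v; have [->|uv] := eqVneq u v; first exact: leq_addr.
by apply: leq_trans (leq_b1 _) _; rewrite ltn_addl // gdist_gt0.
Qed.

(** Optimal transport leaves the mass on the common part of the two balls in
    place and moves that of [w] to [z], which may cost one step only. *)
Lemma ball_diff_adjacent x y w z : e x y ->
  w \in ball e x :\: ball e y -> z \in ball e y :\: ball e x -> e w z.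
Proof.
move=> exy wP zP.
(* the distance to z, truncated at 2 *)
pose f u := if u == z then 0%N else if e u z then 1%N else 2%N.
have f_le2 u : (f u <= 2)%N by rewrite /f; do 2?case: ifP.
have lip u v : (f u <= f v + gdist e u v)%N.
  have [->|uv] := eqVneq u v; first exact: leq_addr.
  have [euv|nuv] := boolP (e u v); last first.
    by apply: leq_trans (f_le2 u) _; rewrite ltn_addl // gdist_gt1.
  rewrite gdist_edge // addn1; have [vz|vz] := eqVneq v z.
    by rewrite /f -vz euv (negPf uv) eqxx.
  apply: leq_trans (f_le2 u) _; rewrite ltnS /f (negPf vz).
  by case: ifP.
have yx1 : ball e y :\: ball e x = [set z].
  apply/eqP; rewrite finset.eqEsubset finset.sub1set zP andbT.
  apply/fintype.subsetP => t tP; rewrite inE; apply/eqP.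
  by apply: (@ball_diff_unique y x); rewrite // sym.
have := @ball_sum f x y exy lip.
rewrite (big_setID (ball e y)) [X in (_ <= X.+1)%N -> _](big_setID (ball e x)).
rewrite /= finset.setIC yx1 big_set1 [f z]/f eqxx addn0 -addn1 leq_add2l.
rewrite (bigD1 w) //= => /(leq_trans (leq_addr _ _)).
have wz : w != z.
  apply: contraTneq wP => ->; move: zP; rewrite !inE => /andP[/negPf -> _].
  by rewrite andbF.
by rewrite /f (negPf wz); case: ifP.
Qed.

Hypotheses (diam2 : gdiam e = 2) (some_edge : exists x y, e x y).

Lemma nonadjacent_common_neighbour x z : z != x -> ~~ e x z ->
  exists2 y, e x y & e y z.
Proof.
move=> zx nxz.
(* Distance 2 yields a walk only if it is below the default value #|V|; a third
   vertex exists since the ends of an edge cannot both lie in {x, z}. *)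
have ltV : (2 < #|V|)%N.
  rewrite ltnNge; apply/negP => leV.
  have full : [set x; z] = [set: V].
    apply/eqP; rewrite eqEcard finset.subsetT cardsT cards2.
    by rewrite eq_sym zx.
  case: some_edge => a [b eab].
  have := finset.in_setT b; have := finset.in_setT a; rewrite -full !inE.
  by case/orP=> /eqP ae /orP[] /eqP be; move: eab;
     rewrite ae be ?irr ?(sym z x) ?(negPf nxz).
have d2 : gdist e x z = 2.
  by apply/eqP; rewrite eqn_leq -{1}diam2 gdist_le_diam gdist_gt1 // eq_sym.
have [|p []] := @gdist_walk _ e x z; first by rewrite d2.
rewrite d2; case: p => [|y [|t [|? ?]]] //= _ /andP[exy /andP[eyt _]] tz.
by exists y; rewrite // -tz.
Qed.

(** Let [y] be a common neighbour.  A neighbour of [x] that is also adjacent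
    to [y] cannot compete with [x] for the single place in
    [ball y :\: ball z]; the other one is matched with [z] across the
    edge [x y]. *)
Lemma nonadjacent_twins x z u : z != x -> ~~ e x z -> e x u -> e u z.
Proof.
move=> zx nxz exu; have [y exy eyz] := nonadjacent_common_neighbour zx nxz.
have [->//|uy] := eqVneq u y.
have uz : u != z by apply: contraTneq exu => ->.
have [eyu|nyu] := boolP (e y u).
  apply: contraT => nuz; move: exu.
  suff -> : u = x by rewrite irr.
  by apply: (@ball_diff_unique y z) => //;
     rewrite !inE ?(negPf uz) ?(sym z) ?(negPf nuz) ?eyu ?orbT //
       1?eq_sym (negPf zx) (negPf nxz) (sym y) exy orbT.
apply: (@ball_diff_adjacent x y); rewrite // !inE.
  by rewrite (negPf uy) (negPf nyu) exu orbT.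
by rewrite (negPf zx) (negPf nxz) eyz orbT.
Qed.

Lemma nonneighbour_unique x z z' :
  z \notin ball e x -> z' \notin ball e x -> z = z'.
Proof.
rewrite !inE !negb_or => /andP[zx nxz] /andP[z'x nxz'].
have [y exy eyz] := nonadjacent_common_neighbour zx nxz.
have eyz' : e y z' by apply: nonadjacent_twins nxz' exy.
apply: (@ball_diff_unique y x); first by rewrite sym.
  by rewrite !inE negb_or zx nxz eyz orbT.
by rewrite !inE negb_or z'x nxz' eyz' orbT.
Qed.

Lemma nonneighbour_exists D x : regular_graph e D ->
  exists z, z \notin ball e x.
Proof.
move=> reg.
have /existsP[x0 /existsP[z0 z0P]] : [exists x0, exists z0, z0 \notin ball e x0].
  apply: contraT; rewrite negb_exists => /forallP all_adj.
  suff : (gdiam e <= 1)%N by rewrite diam2.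
  apply/bigmax_leqP => a _; apply/bigmax_leqP => b _.
  have := all_adj a; rewrite negb_exists => /forallP /(_ b); rewrite negbK inE.
  case/orP=> [/eqP ->|eab]; last by rewrite gdist_edge.
  by apply: leq_trans (@gdist_le_size _ e a a [::] _ _) _.
have : (0 < #|~: ball e x|)%N.
  have -> : #|~: ball e x| = #|~: ball e x0|.
    by rewrite [LHS]cardsCs [RHS]cardsCs !finset.setCK !(card_ball irr reg).
  by apply/card_gt0P; exists z0; rewrite inE.
by case/card_gt0P=> z; rewrite inE => zP; exists z.
Qed.

End SharpGraph.

(** * Recognizing cocktail party graphs *)

(** Each pair [{x, s x}] is indexed by its member of smaller rank in the
    enumeration of [V], and that member becomes the first of the pair. *)
Lemma involution_cocktail_party (V : finType) (e : rel V) (s : V -> V) :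
    involutive s -> (forall x, s x != x) ->
    (forall x y, e x y = (y != x) && (y != s x)) -> (exists x y, e x y) ->
  exists n : nat, (2 <= n)%N /\ graph_iso e (@cocktail_party n).
Proof.
move=> sK s_neq eE [a [b eab]].
pose T := [set x | (enum_rank x < enum_rank (s x))%N].
have sT x : (s x \in T) = (x \notin T).
  rewrite !inE sK -leqNgt ltn_neqAle (inj_eq val_inj) (inj_eq enum_rank_inj).
  by rewrite s_neq.
pose rep x := if x \in T then x else s x.
have repT x : rep x \in T by rewrite /rep; case: ifPn => //; rewrite sT.
pose phi x : 'I_#|T| * bool := (enum_rank_in (repT a) (rep x), x \in T).
pose psi (p : 'I_#|T| * bool) :=
  if p.2 then enum_val p.1 else s (enum_val p.1).
have phiK : cancel phi psi.
  move=> x; rewrite /psi /phi /= enum_rankK_in // /rep.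
  by case: (x \in T); rewrite ?sK.
have psiK : cancel psi phi.
  case=> i []; rewrite /psi /phi /= /rep ?sT enum_valP /= ?sK;
  by rewrite enum_valK_in.
have rep_eq x y : (rep x == rep y) = (y == x) || (y == s x).
  rewrite /rep; apply/idP/idP.
    by case: ifP => _; case: ifP => _ /eqP E; rewrite ?E ?sK ?eqxx ?orbT //;
      rewrite -(inj_eq (can_inj sK)) E eqxx.
  case/orP=> /eqP ->; first exact: eqxx.
  by rewrite sT sK; case: (x \in T).
have iso x y : cocktail_party (phi x) (phi y) = e x y.
  rewrite eE -negb_or -rep_eq /cocktail_party (can_eq phiK) /=.
  rewrite (can_in_eq (enum_rankK_in (repT a))) //.
  by have [->|//] := eqVneq x y; rewrite eqxx.
exists #|T|; split; last by exists phi => //; exists psi.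
have /andP[_ ab] : cocktail_party (phi a) (phi b) by rewrite iso.
by rewrite -[ltnRHS]card_ord; apply/card_gt1P; exists (phi a).1, (phi b).1.
Qed.

Theorem theorem9p1 (R : realType) (V : finType) (e : rel V) (D : nat)
    (he : is_graph e) (hsharp : bonnet_myers_sharp R e D 2) :
  exists n : nat, (2 <= n)%N /\ graph_iso e (@cocktail_party n).
Proof.
case: he => sym irr _ some_edge; case: (hsharp) => reg diam2 _.
have ball_sum (f : V -> nat) x y exy lip :=
  @sharp_ball_sum R V e D irr reg f x y hsharp exy lip.
have unique := nonneighbour_unique sym irr ball_sum diam2 some_edge.
have ex x := nonneighbour_exists irr diam2 x reg.
pose s x := xchoose (ex x).
have sP x : s x \notin ball e x := xchooseP (ex x).
apply: (@involution_cocktail_party _ _ s) => // [x|x|x y].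
- apply: (unique (s x)); first exact: sP.
  by have := sP x; rewrite !inE eq_sym sym.
- by have := sP x; rewrite inE negb_or => /andP[].
- have [->|yx] /= := eqVneq y x; first exact: irr.
  have [->|ysx] /= := eqVneq y (s x).
    by have := sP x; rewrite inE negb_or => /andP[_ /negPf].
  apply: contra_neqT ysx => nxy; apply: (unique x); last exact: sP.
  by rewrite inE negb_or yx.
Qed.
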